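(* Let $W=(W_t)_{t\ge0}$ be a standard Brownian motion and let $f:\mathbb{R}\to\mathbb{R}$ be a measurable function such that $f(W_t)$ is integrable for every $t\ge0$. Then: (a) the process $M_t=f(W_t)-E f(W_t)$, $t\ge0$, is a right-continuous ($P$-a.s.) martingale if and only if $f(x)=ax^2+bx+c$ for all $x\in\mathbb{R}$, for some constants $a,b,c\in\mathbb{R}$; (b) the process $M_t$ is a martingale if and only if $f$ coincides almost everywhere with respect to Lebesgue measure with the function $x\mapsto ax^2+bx+c$ for some constants $a,b,c\in\mathbb{R}$.
   Context: $W$ is a standard Brownian motion on a complete probability space $(\Omega,\mathcal{F},P)$, and $(\mathcal{F}_t)_{t\ge0}$ is the filtration generated by $W$; ''martingale'' means martingale with respect to this filtration. *)

(* Defs.v *)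
From HB Require Import structures.
From mathcomp Require Import all_boot all_order all_algebra.
From mathcomp Require Import all_classical all_reals all_analysis.
Set Implicit Arguments. Unset Strict Implicit. Unset Printing Implicit Defensive.
Import Order.TTheory GRing.Theory Num.Theory.
Import numFieldNormedType.Exports.
Local Open Scope classical_set_scope.
Local Open Scope ring_scope.

Section bm.
Context {d : measure_display} {T : measurableType d} {R : realType}.

Definition complete_prob (P : probability T R) : Prop :=
  forall N : set T, P.-negligible N -> measurable N.

Definition nat_filtration (X : R -> T -> R) (t : R) : set (set T) :=
  <<s [set A | exists s, exists B : set R,
               [/\ 0 <= s <= t, measurable B & A = X s @^-1` B] ] >>.

Definition standard_BM (P : probability T R) (W : R -> T -> R) : Prop :=
  [/\ (forall t, 0 <= t -> measurable_fun setT (W t)),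
      {ae P, forall w, W 0 w = 0},
      {ae P, forall w, {within `[0, +oo[, continuous (fun t => W t w)}},
      (forall s t (B : set R), 0 <= s < t -> measurable B ->
         P [set w | W t w - W s w \in B] = normal_prob 0 (Num.sqrt (t - s)) B) &
      (forall s t (A : set T) (B : set R), 0 <= s <= t ->
         nat_filtration W s A -> measurable B ->
         P (A `&` [set w | (W t w - W s w)%R \in B]) =
         (P A * P [set w | (W t w - W s w)%R \in B])%E)].

Definition martingale (P : probability T R) (F : R -> set (set T))
    (M : R -> T -> R) : Prop :=
  [/\ (forall t, 0 <= t ->
         forall B : set R, measurable B -> F t (M t @^-1` B)),
      (forall t, 0 <= t -> P.-integrable setT (EFin \o M t)) &
      (forall s t (A : set T), 0 <= s <= t -> F s A ->
         (\int[P]_(w in A) (M t w)%:E = \int[P]_(w in A) (M s w)%:E)%E)].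

Definition as_right_continuous (P : probability T R) (M : R -> T -> R) : Prop :=
  {ae P, forall w, forall t, 0 <= t ->
     (fun s => M s w) @ t^'+ --> M t w}.

End bm.

Definition expect {d} {T : measurableType d} {R : realType}
  (P : probability T R) (X : T -> R) : R := fine (\int[P]_w (X w)%:E)%E.

(* Main.v *)
(* Write P_h f x = E f (x + W_h) (gauss_avg below). By the Markov property, M is a
   martingale iff P_h f - f is almost everywhere equal to a constant for every
   h > 0. In that case P_h f, which is smooth, depends on h only through an
   additive constant, so that its time derivative does not depend on x; by the
   heat equation the second derivative of P_1 f is constant, P_1 f is quadratic,
   and so is f up to a null set. Conversely P_h q = q + a h for
   q x = a x^2 + b x + c.
   When moreover M is right-continuous, f (W_r) = q (W_r) for all rational r > 0
   almost surely, hence f (W_t) = q (W_t) for all t > 0 by right-continuity; as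
   every point is visited with positive probability at a positive time, f = q. *)
Require Import Defs.
From HB Require Import structures.
From mathcomp Require Import all_boot all_order all_algebra.
From mathcomp Require Import all_classical all_reals all_analysis.
From mathcomp Require Import measurable_realfun ring lra.
Set Implicit Arguments. Unset Strict Implicit. Unset Printing Implicit Defensive.
Import Order.TTheory GRing.Theory Num.Theory.
Import numFieldNormedType.Exports.
Local Open Scope classical_set_scope.
Local Open Scope ring_scope.

(** * Gaussian moments of a function and their derivatives in the parameters *)

Section gaussian_moments.
Context {R : realType}.
Local Notation mu := (@lebesgue_measure R).
Implicit Types (f : R -> R) (b c x y : R) (k : nat).

(** Up to normalizing constants this is integrability under every centred normal law; the variance
    [h] corresponds to [b] = 1 / (2 h). *)
Definition gauss_integrable f :=
  forall b, 0 < b -> mu.-integrable setT (fun y => (f y * expR (- (b * y ^+ 2)))%:E).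

(** The power [k] closes the family under differentiation: a derivative in [c] raises [k] by one,
    and a derivative in [b] raises it by two and changes the sign. *)
Definition gauss_integrand f k b c y :=
  f y * y ^+ k * expR (c * y - b * y ^+ 2).

Definition gauss_moment f k b c := (\int[mu]_y gauss_integrand f k b c y)%R.

Lemma gauss_weight_le k b0 c0 b c y : 0 < b0 -> b0 <= b -> `|c| <= c0 ->
  `|y| ^+ k * expR (c * y - b * y ^+ 2) <=
  expR ((k%:R + c0) ^+ 2 / (2 * b0)) * expR (- (b0 / 2 * y ^+ 2)).
Proof.
move=> b0_gt0 le_b0b le_cc0.
have le_yk : `|y| ^+ k <= expR (k%:R * `|y|).
  rewrite expRM_natl lerXn2r ?nnegrE ?expR_ge0//.
  by rewrite (le_trans _ (expR_ge1Dx _))// lerDr.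
apply: le_trans (ler_wpM2r (expR_ge0 _) le_yk) _.
rewrite -!expRD ler_expR.
have le_cy : c * y <= c0 * `|y|.
  by rewrite (le_trans (ler_norm _))// normrM ler_wpM2r.
have le_by : b0 * y ^+ 2 <= b * y ^+ 2 by rewrite ler_wpM2r ?sqr_ge0.
have -> : (k%:R + c0) ^+ 2 / (2 * b0) - b0 / 2 * y ^+ 2 =
    (k%:R + c0) * `|y| - b0 * y ^+ 2 + b0 / 2 * (`|y| - (k%:R + c0) / b0) ^+ 2.
  rewrite -(real_normK (num_real y)); field; lra.
have : 0 <= b0 / 2 * (`|y| - (k%:R + c0) / b0) ^+ 2.
  by rewrite mulr_ge0 ?sqr_ge0// divr_ge0// ltW.
nra.
Qed.

Lemma gauss_integrand_le f k b0 c0 b c y : 0 < b0 -> b0 <= b -> `|c| <= c0 ->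
  `|gauss_integrand f k b c y| <=
  `|f y| * (expR ((k%:R + c0) ^+ 2 / (2 * b0)) * expR (- (b0 / 2 * y ^+ 2))).
Proof.
move=> b0_gt0 le_b0b le_cc0.
rewrite /gauss_integrand -mulrA normrM ler_wpM2l// normrM normrX.
by rewrite (ger0_norm (expR_ge0 _)) gauss_weight_le.
Qed.

Variable f : R -> R.
Hypothesis mf : measurable_fun setT f.

Lemma measurable_gauss_integrand k b c :
  measurable_fun setT (gauss_integrand f k b c).
Proof.
apply: measurable_funM; first by apply: measurable_funM => //; exact: exprn_measurable.
apply: measurableT_comp => //; apply: measurable_funB; first exact: mulrl_measurable.
by apply: measurable_funM => //; exact: exprn_measurable.
Qed.

Hypothesis intf : gauss_integrable f.

Lemma integrable_gauss_dominator (C b : R) : 0 < b ->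
  mu.-integrable setT (EFin \o fun y => `|f y| * (C * expR (- (b * y ^+ 2)))).
Proof.
move=> b0; apply: (eq_integrable measurableT
    (fun y : measurableTypeR R => C%:E * `|(f y * expR (- (b * y ^+ 2)))%:E|)%E) => //.
  move=> y _ /=; rewrite normrM (ger0_norm (expR_ge0 _)).
  by rewrite !EFinM muleCA.
by apply: integrableZl => //; apply: integrable_abse; exact: intf.
Qed.

Lemma integrable_gauss_integrand k b c : 0 < b ->
  mu.-integrable setT (EFin \o gauss_integrand f k b c).
Proof.
move=> b0.
apply: (le_integrable _ _ _ (@integrable_gauss_dominator
  (expR ((k%:R + `|c|) ^+ 2 / (2 * b))) (b / 2) _)) => //; last by rewrite divr_gt0.
  by apply/measurable_EFinP; exact: measurable_gauss_integrand.
move=> y _ /=; rewrite lee_fin [leRHS]ger0_norm; last first.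
  by rewrite mulr_ge0// mulr_ge0// expR_ge0.
exact: gauss_integrand_le.
Qed.

(* A line in the parameter plane is all that is needed: the heat kernel
   exp (- (x - y)^2 / 2 t), as a function of y, has parameters
   b = 1 / 2 t and c = x / t, which are affine in 1 / t and in x. *)
Lemma is_derive_gauss_moment k (b c p q s : R) : 0 < b + s * p ->
  is_derive s 1 (fun s => gauss_moment f k (b + s * p) (c + s * q))
    (q * gauss_moment f k.+1 (b + s * p) (c + s * q) -
     p * gauss_moment f k.+2 (b + s * p) (c + s * q)).
Proof.
move=> B_gt0; set B := b + s * p in B_gt0 *.
(* Moving [s] by less than [e] changes [b + s * p] by at most [B / 2], so the quadratic coefficient
   stays at least [B / 2]. The summand 1 covers [p] = 0. *)
pose e := B / (2 * (`|p| + 1)).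
have e_gt0 : 0 < e by rewrite divr_gt0// mulr_gt0// ltr_wpDl.
pose F s' y := gauss_integrand f k (b + s' * p) (c + s' * q) y.
have nearI (s' : R) : s' \in `]s - e, s + e[ -> `|s' - s| < e.
  by rewrite in_itv/= ltr_distl.
have b_ge (s' : R) : s' \in `]s - e, s + e[ -> B / 2 <= b + s' * p.
  move=> /nearI s's.
  have -> : b + s' * p = B + (s' - s) * p by rewrite /B; ring.
  have : `|(s' - s) * p| <= e * (`|p| + 1).
    rewrite normrM ler_pM//; first exact: ltW.
    by rewrite lerDl.
  have -> : e * (`|p| + 1) = B / 2.
    by rewrite /e; field; rewrite gt_eqF// ltr_wpDl.
  rewrite ler_norml => /andP[]; lra.
pose c0 := `|c + s * q| + e * `|q|.
have c_le (s' : R) : s' \in `]s - e, s + e[ -> `|c + s' * q| <= c0.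
  move=> /nearI s's.
  have -> : c + s' * q = (c + s * q) + (s' - s) * q by ring.
  rewrite (le_trans (ler_normD _ _))// lerD2l normrM ler_wpM2r//; exact: ltW.
have B2_gt0 : 0 < B / 2 by rewrite divr_gt0.
pose dF s' y := q * gauss_integrand f k.+1 (b + s' * p) (c + s' * q) y -
                p * gauss_integrand f k.+2 (b + s' * p) (c + s' * q) y.
have derF (s' : R) y : is_derive s' 1 (F ^~ y) (dF s' y).
  rewrite /F /dF /gauss_integrand.
  apply: is_derive_eq.
  rewrite /GRing.scale/= !exprS. ring.
have d1F (s' : R) y : partial1of2 F s' y = dF s' y.
  by rewrite partial1of2E derive_val.
pose K k := expR ((k%:R + c0) ^+ 2 / (2 * (B / 2))).
(* A single dominating function for the parameter derivative on the whole interval, adding the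
   bounds for the powers [k.+1] and [k.+2]. *)
pose G y := `|f y| * ((`|q| * K k.+1 + `|p| * K k.+2) *
                      expR (- (B / 2 / 2 * y ^+ 2))).
have G_ge0 y : 0 <= G y.
  by rewrite mulr_ge0// mulr_ge0 ?expR_ge0// addr_ge0// mulr_ge0// expR_ge0.
have intG : mu.-integrable setT (EFin \o G).
  by apply: integrable_gauss_dominator; rewrite divr_gt0.
have intF (s' : R) : s' \in `]s - e, s + e[ -> mu.-integrable setT (EFin \o F s').
  move=> s's; apply: integrable_gauss_integrand.
  by rewrite (lt_le_trans B2_gt0)// b_ge.
have G_ub (s' : R) y : s' \in `]s - e, s + e[ -> `|partial1of2 F s' y| <= G y.
  move=> s's; rewrite d1F /dF /G.
  have le_K j : `|gauss_integrand f j (b + s' * p) (c + s' * q) y| <=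
      `|f y| * (K j * expR (- (B / 2 / 2 * y ^+ 2))).
    by apply: gauss_integrand_le; rewrite ?b_ge ?c_le.
  rewrite (le_trans (ler_normB _ _))// (normrM q) (normrM p).
  apply: le_trans (lerD (ler_wpM2l (normr_ge0 q) (le_K k.+1))
                        (ler_wpM2l (normr_ge0 p) (le_K k.+2))) _.
  by rewrite le_eqVlt; apply/orP; left; apply/eqP; ring.
have Is : s \in `]s - e, s + e[ by rewrite in_itv/= ltrBlDr !ltrDl e_gt0.
have derF' (s' : R) y : s' \in `]s - e, s + e[ -> setT y -> derivable (F ^~ y) s' 1.
  by move=> _ _; exact: ex_derive.
have G_ub' (s' : R) y : s' \in `]s - e, s + e[ -> setT y -> `|partial1of2 F s' y| <= G y.
  by move=> ? _; exact: G_ub.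
have D1 := @derivable_under_integral R _ _ mu F setT measurableT s (s - e) (s + e)
  Is intF derF' G G_ge0 intG G_ub'.
have D2 := @differentiation_under_integral R _ _ mu F setT measurableT s (s - e) (s + e)
  Is intF derF' G G_ge0 intG G_ub'.
apply: DeriveDef; first exact: D1.
rewrite -derive1E D2.
under eq_Rintegral do rewrite d1F.
have intH j := integrable_gauss_integrand j (c + s * q) B_gt0.
rewrite /dF RintegralB//=.
- by rewrite !RintegralZl.
- by apply: eq_integrable (integrableZl _ q (intH k.+1)).
- by apply: eq_integrable (integrableZl _ p (intH k.+2)).
Qed.

Lemma is_derive_gauss_moment_tilt k (b c : R) : 0 < b ->
  is_derive c 1 (gauss_moment f k b) (gauss_moment f k.+1 b c).
Proof.
move=> b_gt0.
have := @is_derive_gauss_moment k b 0 0 1 c.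
rewrite mulr0 addr0 add0r mulr1 mul0r mul1r subr0 => /(_ b_gt0).
rewrite (_ : (fun _ => _) = gauss_moment f k b)//.
by apply/funext => s; rewrite mulr0 addr0 add0r mulr1.
Qed.

End gaussian_moments.

(** * Integration against normal laws, and translation invariance of Lebesgue measure *)

Section normal_prob_integral.
Context {R : realType}.
Local Notation mu := (@lebesgue_measure R).
Implicit Types (f : R -> \bar R) (m s x : R).

(** The Radon-Nikodym derivative and [normal_pdf] have the same integral over every measurable set,
    hence agree almost everywhere. *)
Lemma ge0_integral_normal_prob m s f : measurable_fun setT f ->
  (forall x, 0 <= f x)%E ->
  (\int[normal_prob m s]_x f x = \int[mu]_x (f x * (normal_pdf m s x)%:E))%E.
Proof.
move=> mf f0.
have dom := @normal_prob_dominates R m s.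
rewrite -(Radon_Nikodym_SigmaFinite.change_of_variables dom)//.
have intg := Radon_Nikodym_SigmaFinite.f_integrable dom.
have mpdf : measurable_fun setT (EFin \o normal_pdf m s).
  by apply/measurable_EFinP; exact: measurable_normal_pdf.
apply: ae_eq_integral => //.
- by apply: emeasurable_funM => //; exact: (measurable_int mu).
- exact: emeasurable_funM.
- apply: ae_eqe_mul2l => /=; apply: integral_ae_eq => //= A _ mA.
  by rewrite -(Radon_Nikodym_SigmaFinite.f_integral dom).
Qed.

Lemma integral_normal_prob m s f : measurable_fun setT f ->
  (\int[normal_prob m s]_x f x = \int[mu]_x (f x * (normal_pdf m s x)%:E))%E.
Proof.
move=> mf.
rewrite integralE [RHS]integralE !ge0_integral_normal_prob//.
- have pdf0 x : (0 <= normal_pdf m s x)%R by exact: normal_pdf_ge0.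
  congr (_ - _)%E; apply: eq_integral => x _.
    by rewrite !funeposE muleC maxe_pMr ?lee_fin// mule0 muleC.
  by rewrite !funenegE muleC maxe_pMr ?lee_fin// mule0 muleN muleC.
- exact: measurable_funeneg.
- exact: measurable_funepos.
Qed.

Lemma integrable_normal_prob m s f : measurable_fun setT f ->
  (normal_prob m s).-integrable setT f <->
  mu.-integrable setT (fun x => f x * (normal_pdf m s x)%:E)%E.
Proof.
move=> mf.
have mpdf : measurable_fun setT (EFin \o normal_pdf m s).
  by apply/measurable_EFinP; exact: measurable_normal_pdf.
have E : (\int[normal_prob m s]_x `|f x| =
          \int[mu]_x `|f x * (normal_pdf m s x)%:E|)%E.
  rewrite ge0_integral_normal_prob//; last exact: measurableT_comp.
  apply: eq_integral => x _; rewrite abseM; congr (_ * _)%E.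
  by rewrite gee0_abs// lee_fin normal_pdf_ge0.
split=> /integrableP[_ lty]; apply/integrableP; split => //.
- exact: emeasurable_funM.
- by rewrite -E.
- by rewrite E.
Qed.

Lemma normal_pdf_gt0 m s x : s != 0 -> 0 < normal_pdf m s x.
Proof.
by move=> s0; rewrite normal_pdfE// mulr_gt0 ?normal_peak_gt0// expR_gt0.
Qed.

Lemma normal_prob_eq0 m s (A : set R) : s != 0 -> measurable A ->
  normal_prob m s A = 0%E -> mu A = 0%E.
Proof.
move=> s0 mA NA0.
have mpdf : measurable_fun A (EFin \o normal_pdf m s).
  by apply/measurable_funTS/measurable_EFinP; exact: measurable_normal_pdf.
have /(ae_eq_integral_abs mu mA mpdf) : (\int[mu]_(x in A) `|(normal_pdf m s x)%:E| = 0)%E.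
  rewrite -NA0; apply: eq_integral => x _.
  by rewrite gee0_abs// lee_fin normal_pdf_ge0.
case=> N [mN muN0 NA]; apply: (subset_measure0 _ mN) => // x Ax.
apply: NA => /= /(_ Ax) [/eqP].
by rewrite gt_eqF// normal_pdf_gt0.
Qed.

(** A nondegenerate normal law has a positive density, so it has the same null sets as Lebesgue
    measure. *)
Lemma ae_normal_prob m s (Q : R -> Prop) : s != 0 ->
  {ae normal_prob m s, forall x, Q x} <-> {ae mu, forall x, Q x}.
Proof.
move=> s0; split=> -[N [mN N0 QN]]; exists N; split=> //.
- exact: normal_prob_eq0 N0.
- apply/eqP; rewrite eq_le measure_ge0 andbT.
  by have /null_content_dominatesP/(_ _ mN N0) -> := @normal_prob_dominates R m s.
Qed.

Lemma measurable_translation x :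
  measurable_fun setT (fun z : measurableTypeR R => x + z : measurableTypeR R).
Proof. exact: measurable_funD. Qed.

(** By uniqueness of Lebesgue measure it suffices to compare the two measures on half-open
    intervals. *)
Lemma lebesgue_measure_translation x (A : set R) : measurable A ->
  pushforward mu (fun z : measurableTypeR R => x + z : measurableTypeR R)%R A = mu A.
Proof.
move=> mA; apply/esym.
apply: lebesgue_measure_unique => //; first exact: measurable_translation.
move=> mx /= _ [[a b]] _ <-.
rewrite (_ : pushforward _ _ _ = mu `]a - x, b - x]%classic); last first.
  congr (mu _); apply/seteqP; split=> z /=; rewrite !in_itv/= ltrBlDl lerBrDl//.
rewrite !lebesgue_measure_itv/= !lte_fin ltrD2r; case: ifP => // _.
by rewrite -!EFinB opprB addrA subrK.
Qed.

Lemma ge0_integral_translation x f : measurable_fun setT f ->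
  (forall y, 0 <= f y)%E -> (\int[mu]_z f (x + z)%R = \int[mu]_y f y)%E.
Proof.
move=> mf f0.
have f0' : {in [set: R], forall y, (0 <= f y)%E} by move=> y _; exact: f0.
rewrite -[LHS](ge0_integral_pushforward (measurable_translation x) mu measurableT mf f0').
apply: eq_measure_integral => [|m A mA _]; first exact: measurable_translation.
exact: lebesgue_measure_translation.
Qed.

Lemma integral_translation x f : measurable_fun setT f ->
  (\int[mu]_z f (x + z)%R = \int[mu]_y f y)%E.
Proof.
move=> mf; rewrite integralE [RHS]integralE.
rewrite -(@ge0_integral_translation x f^\+%E)//; last exact: measurable_funepos.
rewrite -(@ge0_integral_translation x f^\-%E)//; last exact: measurable_funeneg.
by congr (_ - _)%E; apply: eq_integral => y _; rewrite ?funeposE ?funenegE.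
Qed.

Lemma integrable_translation x f :
  mu.-integrable setT f -> mu.-integrable setT (fun z => f (x + z)).
Proof.
move=> /integrableP[mf lty]; apply/integrableP; split.
  by apply: (measurableT_comp mf); exact: measurable_translation.
rewrite (@ge0_integral_translation x (fun y => `|f y|)%E)//.
exact: measurableT_comp.
Qed.

Lemma normal_pdf_translation x s z : s != 0 ->
  normal_pdf 0 s z = normal_pdf x s (x + z).
Proof.
by move=> s0; rewrite !normal_pdfE// /normal_fun (addrC x) addrK subr0.
Qed.

End normal_prob_integral.

(** * Gaussian averages expressed through Gaussian moments *)

Section gauss_avg.
Context {R : realType}.
Local Notation mu := (@lebesgue_measure R).
Implicit Types (f : R -> R) (h x : R).

Definition gauss_avg h f x :=
  (\int[normal_prob 0 (Num.sqrt h)]_z f (x + z)%R)%R.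

(** Expanding the square in the exponent isolates a factor free of [y]; the rest is the weight of
    [gauss_integrand] with [b] = 1 / (2 h) and [c] = x / h. *)
Lemma normal_pdf_sqrtE h x y : 0 < h ->
  normal_pdf x (Num.sqrt h) y =
  normal_peak (Num.sqrt h) * expR (- (x ^+ 2 / (2 * h))) *
  expR (x / h * y - (2 * h)^-1 * y ^+ 2).
Proof.
move=> h0; rewrite normal_pdfE ?gt_eqF ?sqrtr_gt0// -mulrA -expRD.
congr (_ * expR _); rewrite sqr_sqrtr ?ltW// -mulr_natl; field.
by rewrite gt_eqF.
Qed.

Lemma gauss_integrable_normal_prob f : measurable_fun setT f ->
  (forall h, 0 < h -> (normal_prob 0 (Num.sqrt h)).-integrable setT (EFin \o f)) ->
  gauss_integrable f.
Proof.
move=> mf intf b b0; pose h := (2 * b)^-1.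
have h0 : 0 < h by rewrite invr_gt0 mulr_gt0.
have mEf : measurable_fun setT (EFin \o f) by exact/measurable_EFinP.
have /(integrable_normal_prob _ _ mEf)/(integrableZl measurableT
  (normal_peak (Num.sqrt h))^-1) := intf h h0.
apply: eq_integrable => //= y _.
rewrite -!EFinM; congr EFin.
rewrite normal_pdf_sqrtE// expr0n/= !mul0r oppr0 expR0 sub0r mulr1.
have -> : (2 * h)^-1 = b by rewrite /h; field; rewrite gt_eqF.
rewrite mulrCA mulKf//.
by rewrite gt_eqF// normal_peak_gt0// gt_eqF// sqrtr_gt0.
Qed.

Section gauss_avg_moment.
Variables (f : R -> R) (h x : R).
Hypotheses (mf : measurable_fun setT f) (intf : gauss_integrable f) (h0 : 0 < h).

Let h2_gt0 : 0 < (2 * h)^-1. Proof. by rewrite invr_gt0 mulr_gt0. Qed.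

Let integrand_pdfE y : f y * normal_pdf x (Num.sqrt h) y =
  normal_peak (Num.sqrt h) * expR (- (x ^+ 2 / (2 * h))) *
  gauss_integrand f 0 (2 * h)^-1 (x / h) y.
Proof. by rewrite normal_pdf_sqrtE// /gauss_integrand expr0 mulr1 mulrCA. Qed.

Let integrable_pdf :
  mu.-integrable setT (fun y => (f y * normal_pdf x (Num.sqrt h) y)%:E).
Proof.
have := integrableZl measurableT
  (normal_peak (Num.sqrt h) * expR (- (x ^+ 2 / (2 * h))))
  (integrable_gauss_integrand mf intf 0 (x / h) h2_gt0).
by apply: eq_integrable => // y _; rewrite integrand_pdfE EFinM.
Qed.

Lemma integrable_gauss_avg :
  (normal_prob 0 (Num.sqrt h)).-integrable setT (fun z => (f (x + z))%:E).
Proof.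
apply/integrable_normal_prob.
  apply/measurable_EFinP; apply: (measurableT_comp mf).
  exact: measurable_translation.
have := integrable_translation x integrable_pdf.
apply: eq_integrable => // z _.
by rewrite EFinM -normal_pdf_translation// gt_eqF// sqrtr_gt0.
Qed.

(** Substitute y = x + z and expand the kernel by [normal_pdf_sqrtE]. In this form [x] and [h] enter
    only through smooth factors and the parameters of a moment, which can be differentiated. *)
Lemma gauss_avgE : gauss_avg h f x =
  normal_peak (Num.sqrt h) * expR (- (x ^+ 2 / (2 * h))) *
  gauss_moment f 0 (2 * h)^-1 (x / h).
Proof.
rewrite /gauss_avg /Rintegral integral_normal_prob; last first.
  apply/measurable_EFinP; apply: (measurableT_comp mf).
  exact: measurable_translation.
transitivity (fine (\int[mu]_y (f y * normal_pdf x (Num.sqrt h) y)%:E)%E).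
  rewrite -[X in _ = fine X](integral_translation x); last first.
    exact: (measurable_int mu integrable_pdf).
  congr fine; apply: eq_integral => z _; rewrite EFinM.
  by rewrite -normal_pdf_translation// gt_eqF// sqrtr_gt0.
rewrite -[LHS]/(\int[mu]_y (f y * normal_pdf x (Num.sqrt h) y))%R.
under eq_Rintegral do rewrite integrand_pdfE.
by rewrite RintegralZl//; exact: integrable_gauss_integrand.
Qed.

End gauss_avg_moment.

Lemma gauss_integrable_cst (k : R) : gauss_integrable (fun=> k).
Proof.
apply: gauss_integrable_normal_prob => // h h0.
exact: finite_measure_integrable_cst.
Qed.

Lemma gauss_avg_cst h x k : gauss_avg h (fun=> k) x = k.
Proof.
by rewrite /gauss_avg Rintegral_cst//= (@probability_setT _ _ _ (normal_prob _ _)) mulr1.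
Qed.

End gauss_avg.

(** Lets [filterS] and [filterS2] act on statements that hold Lebesgue-almost everywhere. *)
#[local] Instance lebesgue_ae_filter (R : realType) :
  Filter (almost_everywhere (@lebesgue_measure R)) :=
  ae_filter_ringOfSetsType (@lebesgue_measure R).

Section gaussian_quadratic.
Context {R : realType}.
Local Notation mu := (@lebesgue_measure R).
Implicit Types (f : R -> R) (h x : R).

(** * Mean and variance of a centred normal law, from its moment generating function *)

Section normal_moments.
Variable h : R.
Hypothesis h_gt0 : 0 < h.
Let one : R -> R := fun=> 1.
Let mone : measurable_fun setT one. Proof. exact: measurable_cst. Qed.
Let intone : gauss_integrable one. Proof. exact: gauss_integrable_cst. Qed.
Let h2_gt0 : 0 < (2 * h)^-1. Proof. by rewrite invr_gt0 mulr_gt0. Qed.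
Let peak_gt0 : 0 < normal_peak (Num.sqrt h).
Proof. by rewrite normal_peak_gt0// gt_eqF// sqrtr_gt0. Qed.

Let pow_pdfE k z : z ^+ k * normal_pdf 0 (Num.sqrt h) z =
  normal_peak (Num.sqrt h) * gauss_integrand one k (2 * h)^-1 0 z.
Proof.
rewrite normal_pdf_sqrtE// expr0n/= !mul0r oppr0 expR0 mulr1.
by rewrite /gauss_integrand /one mul1r mul0r mulrCA.
Qed.

Let integrable_pow_pdf k :
  mu.-integrable setT (fun z => (z ^+ k * normal_pdf 0 (Num.sqrt h) z)%:E).
Proof.
have := integrableZl measurableT (normal_peak (Num.sqrt h))
  (integrable_gauss_integrand mone intone k 0 h2_gt0).
by apply: eq_integrable => // y _; rewrite pow_pdfE EFinM.
Qed.

Lemma integrable_normal_prob_pow k :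
  (normal_prob 0 (Num.sqrt h)).-integrable setT (fun z => (z ^+ k)%:E).
Proof.
apply/integrable_normal_prob.
  by apply/measurable_EFinP; exact: exprn_measurable.
by apply: eq_integrable (integrable_pow_pdf k) => // z _; rewrite EFinM.
Qed.

Lemma normal_prob_powE k : (\int[normal_prob 0 (Num.sqrt h)]_z (z ^+ k)%R)%R =
  normal_peak (Num.sqrt h) * gauss_moment one k (2 * h)^-1 0.
Proof.
rewrite /Rintegral integral_normal_prob; last first.
  by apply/measurable_EFinP; exact: exprn_measurable.
rewrite -[RHS]RintegralZl//; last exact: integrable_gauss_integrand.
by congr fine; apply: eq_integral => z _; rewrite -EFinM pow_pdfE.
Qed.

(* [gauss_avg_cst] with the constant 1, at the point where x / h = c. *)
Let moment0E c : gauss_moment one 0 (2 * h)^-1 c =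
  (normal_peak (Num.sqrt h))^-1 * expR (h / 2 * c ^+ 2).
Proof.
have /esym := gauss_avgE (c * h) mone intone h_gt0.
rewrite [RHS]gauss_avg_cst mulfK ?gt_eqF// => E.
apply: (mulfI (lt0r_neq0 peak_gt0)).
rewrite mulVKf ?gt_eqF//.
apply: (mulfI (lt0r_neq0 (expR_gt0 (- ((c * h) ^+ 2 / (2 * h)))))).
rewrite mulrCA mulrA E -expRD -[LHS]expR0; congr expR; field.
by rewrite gt_eqF.
Qed.

(** Differentiating [moment0E] in the tilt brings down one factor y; differentiating again, at 0,
    gives [moment2E]. *)
Let moment1E c : gauss_moment one 1 (2 * h)^-1 c =
  (normal_peak (Num.sqrt h))^-1 * (h * c) * expR (h / 2 * c ^+ 2).
Proof.
have D := is_derive_gauss_moment_tilt mone intone 0 c h2_gt0.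
rewrite -(@derive_val _ _ _ _ _ _ _ D).
rewrite (_ : gauss_moment one 0 _ = fun c =>
  (normal_peak (Num.sqrt h))^-1 * expR (h / 2 * c ^+ 2)); last exact/funext/moment0E.
apply: derive_val; apply: is_derive_eq.
rewrite /GRing.scale/=; field. by rewrite gt_eqF.
Qed.

Let moment2E : gauss_moment one 2 (2 * h)^-1 0 =
  (normal_peak (Num.sqrt h))^-1 * h.
Proof.
have D := is_derive_gauss_moment_tilt mone intone 1 0 h2_gt0.
rewrite -(@derive_val _ _ _ _ _ _ _ D).
rewrite (_ : gauss_moment one 1 _ = fun c =>
  (normal_peak (Num.sqrt h))^-1 * (h * c) * expR (h / 2 * c ^+ 2)); last exact/funext/moment1E.
apply: derive_val; apply: is_derive_eq.
rewrite /GRing.scale/= expr0n/= !mulr0 expR0; field. by rewrite gt_eqF.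
Qed.

Lemma normal_prob_mean : (\int[normal_prob 0 (Num.sqrt h)]_z z)%R = 0 :> R.
Proof.
have := normal_prob_powE 1.
by rewrite moment1E mulr0 mulr0 mul0r mulr0.
Qed.

Lemma normal_prob_variance :
  (\int[normal_prob 0 (Num.sqrt h)]_z (z ^+ 2)%R)%R = h.
Proof. by rewrite normal_prob_powE moment2E mulVKf// gt_eqF. Qed.

(** Expand the quadratic at x + z in powers of z: the linear term has mean zero and the square
    contributes the variance [h]. *)
Lemma gauss_avg_quadratic (a b c x : R) :
  gauss_avg h (fun y => a * y ^+ 2 + b * y + c) x =
  a * x ^+ 2 + b * x + c + a * h.
Proof.
pose N := normal_prob 0 (Num.sqrt h) : {measure set _ -> \bar R}.
have int1 := integrable_normal_prob_pow 1.
have int2 := integrable_normal_prob_pow 2.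
have intZ (k : R) g : N.-integrable setT (EFin \o g) ->
    N.-integrable setT (EFin \o (fun z => k * g z)).
  by move=> intg; apply: eq_integrable (integrableZl measurableT k intg).
have intk (k : R) : N.-integrable setT (EFin \o (fun=> k)).
  exact: finite_measure_integrable_cst.
rewrite /gauss_avg.
under eq_Rintegral => z _.
  rewrite (_ : _ + c = (a * x ^+ 2 + b * x + c) +
                       ((2 * a * x + b) * z + a * z ^+ 2)); last by ring.
  over.
rewrite RintegralD//; last first.
  by apply: eq_integrable (integrableD measurableT (intZ (2 * a * x + b) _ int1) (intZ a _ int2)).
rewrite [X in _ + X]RintegralD//; [|exact: intZ int1|exact: intZ int2].
rewrite !RintegralZl// normal_prob_mean normal_prob_variance mulr0 add0r.
by rewrite Rintegral_cst//= (@probability_setT _ _ _ (normal_prob _ _)) mulr1.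
Qed.

End normal_moments.

(** If [g x] differed from [k], continuity would put a whole interval around [x] into the
    exceptional null set, although intervals have positive length. *)
Lemma ae_continuous_cst (g : R -> R) (k : R) : continuous g ->
  {ae mu, forall x, g x = k} -> forall x, g x = k.
Proof.
move=> cg [N [mN N0 gN]] x; apply/eqP/negP => /negP gxk.
have /cvgrPdist_lt/(_ `|g x - k|) := cg x.
rewrite normr_gt0 subr_eq0 => /(_ gxk)[e /= e0 xe].
have sub : `]x - e, x + e[ `<=` N.
  move=> y /=; rewrite in_itv/= -ltr_distl distrC => xye; apply: gN => /= gy.
  by have := xe y xye; rewrite gy ltxx.
have : mu `]x - e, x + e[%classic = 0%E by apply: (subset_measure0 _ mN).
rewrite [LHS]lebesgue_measure_itv/= lte_fin ltrD2l gtrN// => -[].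
rewrite opprD opprK addrACA subrr add0r => /eqP.
by rewrite gt_eqF// addr_gt0.
Qed.

(** * The heat equation, and functions that averaging only shifts by a constant *)

Section heat_equation.
Variable f : R -> R.
Hypotheses (mf : measurable_fun setT f) (intf : gauss_integrable f).

(** This is E (f (Y) Y^k) for Y normal with mean [x] and variance [h]; the case [k] = 0 is
    [gauss_avg h f x]. *)
Definition tilted_moment h k x := normal_peak (Num.sqrt h) *
  expR (- (x ^+ 2 / (2 * h))) * gauss_moment f k (2 * h)^-1 (x / h).

(** The normal density at y has logarithmic derivative (y - x) / h in its mean, which yields one
    moment of order [k.+1] and one of order [k]. *)
Lemma is_derive_tilted_moment h k x : 0 < h ->
  is_derive x 1 (tilted_moment h k)
    ((tilted_moment h k.+1 x - x * tilted_moment h k x) / h).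
Proof.
move=> h0.
have h2 : 0 < (2 * h)^-1 by rewrite invr_gt0 mulr_gt0.
have D := is_derive_gauss_moment_tilt mf intf k (x / h) h2.
have Di : is_derive x 1 (fun x => x / h) h^-1.
  by apply: is_derive_eq; rewrite /GRing.scale/= mulr0 add0r mulr1.
have := @is_derive1_comp _ _ (fun x => x / h) x _ _ D Di.
rewrite /comp => Dc.
apply: is_derive_eq; rewrite /GRing.scale/= /tilted_moment; field.
by rewrite gt_eqF.
Qed.

Lemma continuous_gauss_avg h : 0 < h -> continuous (gauss_avg h f).
Proof.
move=> h0; rewrite (_ : gauss_avg h f = tilted_moment h 0); last first.
  by apply/funext => x; exact: gauss_avgE.
move=> x; apply/differentiable_continuous/derivable1_diffP.
by have [] := is_derive_tilted_moment 0 x h0.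
Qed.

(* The heat equation at time 1: by [is_derive_tilted_moment] the right-hand
   side is minus half the second derivative of [gauss_avg 1 f] at x. Writing the
   time as (expR v)^-1 keeps it positive for all v. *)
Lemma is_derive_gauss_avg_time x :
  is_derive (0 : R) 1 (fun v => gauss_avg (expR v)^-1 f x)
    (- ((tilted_moment 1 2 x - 2 * x * tilted_moment 1 1 x +
        (x ^+ 2 - 1) * tilted_moment 1 0 x) / 2)).
Proof.
(* At time [(expR v)^-1] the moment parameters are [expR v * 2^-1] and [expR v * x], a line in
   [expR v], so [is_derive_gauss_moment] and the chain rule apply. The term [v / 2] in the exponent
   comes from the peak of the density. *)
rewrite (_ : (fun v => _) = (fun v => normal_peak 1 *
    expR (v / 2 - expR v * (x ^+ 2 / 2)) *
    gauss_moment f 0 (0 + expR v * 2^-1) (0 + expR v * x))); last first.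
  apply/funext => v; rewrite gauss_avgE ?invr_gt0 ?expR_gt0//.
  have -> : (2 * (expR v)^-1)^-1 = 0 + expR v * 2^-1.
    by rewrite add0r invfM invrK mulrC.
  have -> : x / (expR v)^-1 = 0 + expR v * x by rewrite add0r invrK mulrC.
  congr (_ * _); rewrite expRD [RHS]mulrA; congr (_ * _); last first.
    by congr expR; field.
  rewrite /normal_peak sqr_sqrtr ?invr_ge0 ?expR_ge0// expr1n mul1r.
  rewrite -mulrnAr sqrtrM ?invr_ge0 ?expR_ge0// invfM mulrC; congr (_ * _).
  have -> : (expR v)^-1 = expR (- (v / 2)) ^+ 2.
    by rewrite -expRM_natl -expRN; congr expR; field.
  by rewrite sqrtr_sqr ger0_norm ?expR_ge0// -expRN opprK.
have e0 : 0 < 0 + expR 0 * 2^-1 :> R by rewrite add0r divr_gt0 ?expR_gt0.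
have D := is_derive_gauss_moment mf intf 0 0 x e0.
have := is_derive1_comp D (is_derive_expR 0).
rewrite /comp => Dc.
apply: is_derive_eq.
rewrite /GRing.scale/= /tilted_moment sqrtr1 expR0 !add0r !mul1r !mulr1 mul0r sub0r.
by rewrite !divr1; field.
Qed.

Lemma gauss_avg_shift_quadratic :
  (forall h, 0 < h ->
     exists k, {ae mu, forall x, gauss_avg h f x = f x + k}) ->
  exists a b c : R, {ae mu, forall x, f x = a * x ^+ 2 + b * x + c}.
Proof.
move=> shift.
have [k1 shift1] := shift 1 ltr01.
(* Both averages equal [f] plus a constant almost everywhere; being continuous, they differ by a
   constant at every point. *)
have shift_exp v : exists k, forall x,
    gauss_avg (expR v)^-1 f x = gauss_avg 1 f x + k.
  have v0 : 0 < (expR v)^-1 by rewrite invr_gt0 expR_gt0.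
  have [k shiftv] := shift _ v0.
  exists (k - k1) => x; apply/eqP; rewrite addrC -subr_eq; apply/eqP.
  apply: (@ae_continuous_cst (fun x => gauss_avg (expR v)^-1 f x - gauss_avg 1 f x)).
    by move=> y; apply: cvgB; exact: continuous_gauss_avg.
  by move: shift1; apply: filterS2 shiftv => y -> ->; ring.
pose g := gauss_avg 1 f.
(* The averages at two times differ by a constant in x, so the time derivative
   does not depend on x, and neither does the second derivative g2 of g. *)
pose g2 x := tilted_moment 1 2 x - 2 * x * tilted_moment 1 1 x +
        (x ^+ 2 - 1) * tilted_moment 1 0 x.
have g2_cst x : g2 x = g2 0.
  have /(@derive_val _ _ _ _ _ _ _) Dx := is_derive_gauss_avg_time x.
  have /(@derive_val _ _ _ _ _ _ _) D0 := is_derive_gauss_avg_time 0.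
  apply: (mulIf (_ : 2^-1 != 0)) => //; apply: oppr_inj.
  rewrite -[LHS]Dx -[RHS]D0.
  (* The shift in [shift_exp] depends on [v] but not on the point, so it cancels between [x] and
     0. *)
  have gE v : gauss_avg (expR v)^-1 f x =
      gauss_avg (expR v)^-1 f 0 + (g x - g 0).
    by have [k vk] := shift_exp v; rewrite !vk; rewrite /g; ring.
  rewrite (_ : (fun v => gauss_avg (expR v)^-1 f x) =
      (fun v => gauss_avg (expR v)^-1 f 0) \+ cst (g x - g 0)).
    rewrite deriveD//; first by rewrite derive_cst addr0.
    by have [] := is_derive_gauss_avg_time 0.
  by apply/funext => v; rewrite gE.
(* [g1] is the derivative of [g], and [g2] that of [g1]; since [g2] is constant, two integrations
   give a quadratic. *)
pose g1 x := tilted_moment 1 1 x - x * tilted_moment 1 0 x.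
have gE : g = tilted_moment 1 0 by apply/funext => x; exact: gauss_avgE.
have Dg x : is_derive x 1 g (g1 x).
  rewrite gE.
  by have := is_derive_tilted_moment 0 x ltr01; rewrite divr1.
have Dg1 x : is_derive x 1 g1 (g2 0).
  rewrite -(g2_cst x).
  have D0 := is_derive_tilted_moment 0 x ltr01.
  have D1 := is_derive_tilted_moment 1 x ltr01.
  by apply: is_derive_eq; rewrite /GRing.scale/= /g2; field.
have g1E x : g1 x = g2 0 * x + g1 0.
  have D (y : R) : is_derive y 1 (fun y => g1 y - g2 0 * y) 0.
    by apply: is_derive_eq; rewrite /GRing.scale/=; ring.
  have := @is_derive_0_is_cst _ (fun y => g1 y - g2 0 * y) x 0 D.
  by rewrite mulr0 subr0 => <-; ring.
have gE' x : g x = g2 0 / 2 * x ^+ 2 + g1 0 * x + g 0.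
  have D (y : R) : is_derive y 1 (fun y => g y - (g2 0 / 2 * y ^+ 2 + g1 0 * y)) 0.
    by apply: is_derive_eq; rewrite /GRing.scale/= g1E; field.
  have := @is_derive_0_is_cst _ (fun y => g y - (g2 0 / 2 * y ^+ 2 + g1 0 * y)) x 0 D.
  by rewrite expr0n/= !mulr0 addr0 subr0 => <-; ring.
(* Subtracting [k1] undoes the shift between [f] and its average at time 1. *)
exists (g2 0 / 2), (g1 0), (g 0 - k1).
by apply: filterS shift1 => x; rewrite -/(g x) gE' => E; apply: (addIr k1); rewrite -E; ring.
Qed.

End heat_equation.
End gaussian_quadratic.

(** * Change of variables and integration of independent variables *)

Section pushforward_integral.
Context d1 d2 {X : measurableType d1} {Y : measurableType d2} {R : realType}.
Variables (mu : {measure set X -> \bar R}) (phi : X -> Y).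
Hypothesis mphi : measurable_fun setT phi.

(* Unlike [integral_pushforward], no integrability is assumed. *)
Lemma integral_pushforward_measurable (nu : {measure set Y -> \bar R}) (D : set Y)
    (f : Y -> \bar R) : (forall A, measurable A -> mu (phi @^-1` A) = nu A) ->
  measurable D -> measurable_fun D f ->
  (\int[mu]_(x in phi @^-1` D) f (phi x) = \int[nu]_(y in D) f y)%E.
Proof.
move=> nuE mD mf.
have ge0E (g : Y -> \bar R) : measurable_fun D g -> (forall y, 0 <= g y)%E ->
    (\int[mu]_(x in phi @^-1` D) g (phi x) = \int[nu]_(y in D) g y)%E.
  move=> mg g0; have g0' : {in D, forall y, (0 <= g y)%E} by move=> y _; exact: g0.
  rewrite -[LHS](ge0_integral_pushforward mphi mu mD mg g0').
  by apply: eq_measure_integral => A mA _; exact: nuE.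
rewrite [LHS]integralE [RHS]integralE.
rewrite -(ge0E f^\+%E)//; last exact: measurable_funepos.
rewrite -(ge0E f^\-%E)//; last exact: measurable_funeneg.
by congr (_ - _)%E; apply: eq_integral => y _; rewrite ?funeposE ?funenegE.
Qed.

Lemma integrable_pushforward_measurable (nu : {measure set Y -> \bar R})
    (f : Y -> \bar R) : (forall A, measurable A -> mu (phi @^-1` A) = nu A) ->
  measurable_fun setT f ->
  nu.-integrable setT f <-> mu.-integrable setT (f \o phi).
Proof.
move=> nuE mf.
have E : (\int[mu]_x `|f (phi x)| = \int[nu]_y `|f y|)%E.
  by apply: (integral_pushforward_measurable nuE measurableT); exact: measurableT_comp.
split=> /integrableP[_ lty]; apply/integrableP; split => //.
- exact: measurableT_comp.
- by rewrite E.
- by rewrite -E.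
Qed.

End pushforward_integral.

(** The factorization on rectangles identifies the joint law of [X] and [Z] with a product measure;
    Fubini's theorem then integrates [Z] out first. *)
Lemma integral_independent d d1 d2 (T : measurableType d) (T1 : measurableType d1)
    (T2 : measurableType d2) (R : realType) (P : probability T R)
    (N : probability T2 R) (X : T -> T1) (Z : T -> T2) (g : T1 * T2 -> \bar R) :
  measurable_fun setT X -> measurable_fun setT Z ->
  (forall B C, measurable B -> measurable C ->
     P (X @^-1` B `&` Z @^-1` C) = P (X @^-1` B) * N C)%E ->
  measurable_fun setT g -> P.-integrable setT (fun w => g (X w, Z w)) ->
  (\int[P]_w g (X w, Z w) = \int[P]_w \int[N]_z g (X w, z))%E.
Proof.
move=> mX mZ indep mg intg.
pose X' : {mfun T >-> T1} := mfun_Sub (mem_set mX).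
pose PX : probability T1 R := distribution P X'.
have mXZ : measurable_fun setT (fun w => (X w, Z w)) by exact: measurable_fun_pair.
pose XZ : {mfun T >-> (T1 * T2)%type} := mfun_Sub (mem_set mXZ).
pose PXZ : probability (T1 * T2)%type R := distribution P XZ.
have PXZE A : measurable A -> P ((fun w => (X w, Z w)) @^-1` A) = (PX \x N)%E A.
  move=> mA; apply/esym.
  by apply: (@product_measure_unique _ _ _ _ _ PX N PXZ).
rewrite [LHS](integral_pushforward_measurable mXZ PXZE measurableT mg).
have intPN : (PX \x N)%E.-integrable setT g.
  by apply/(integrable_pushforward_measurable mXZ PXZE mg).
rewrite -integral12_prod_meas1//.
rewrite -[LHS](@integral_pushforward_measurable _ _ _ _ _ P X mX)//.
exact: (measurable_fubini_F intPN).
Qed.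

(** * Laws, increments and the Markov property of Brownian motion *)

Section brownian_motion.
Context {d : measure_display} {T : measurableType d} {R : realType}.
Variables (P : probability T R) (W : R -> T -> R).
Hypothesis BM : standard_BM P W.
Implicit Types (f : R -> R) (s t : R) (A : set T).

Lemma measurable_BM t : 0 <= t -> measurable_fun setT (W t).
Proof. by case: BM => + _ _ _ _; apply. Qed.

Lemma nat_filtration_measurable s A : 0 <= s -> nat_filtration W s A -> measurable A.
Proof.
move=> s0; apply: smallest_sub; first exact: sigma_algebra_measurable.
move=> _ [r [B [/andP[r0 _] mB ->]]].
by rewrite -[X in measurable X]setTI; exact: measurable_BM.
Qed.

Lemma nat_filtration_preimage r s (B : set R) : 0 <= r <= s -> measurable B ->
  nat_filtration W s (W r @^-1` B).
Proof. by move=> rs mB; apply: sub_sigma_algebra; exists r, B. Qed.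

Lemma nat_filtrationT s : nat_filtration W s setT.
Proof. exact: (@measurableT _ (g_sigma_algebraType _)). Qed.

Lemma measurable_BM_increment s t : 0 <= s <= t ->
  measurable_fun setT (fun w => W t w - W s w).
Proof.
by move=> /andP[s0 st]; apply: measurable_funB; apply: measurable_BM => //; exact: le_trans st.
Qed.

Lemma BM_increment s t A (B : set R) : 0 <= s < t -> nat_filtration W s A ->
  measurable B ->
  (P (A `&` (fun w => W t w - W s w)%R @^-1` B) =
   P A * normal_prob 0 (Num.sqrt (t - s)) B)%E.
Proof.
move=> /andP[s0 st] FA mB; case: BM => _ _ _ law indep.
have E : (fun w => W t w - W s w) @^-1` B = [set w | (W t w - W s w)%R \in B].
  by apply/seteqP; split => w /=; rewrite inE.
by rewrite E indep ?s0 ?(ltW st)// law ?s0.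
Qed.

Lemma BM_law t (B : set R) : 0 < t -> measurable B ->
  P (W t @^-1` B) = normal_prob 0 (Num.sqrt t) B.
Proof.
move=> t0 mB; have [_ W0 _ _ _] := BM.
have := BM_increment (_ : 0 <= 0 < t) (@nat_filtrationT 0) mB.
rewrite lexx t0 setTI probability_setT mul1e subr0 => <-//.
have mI : measurable ((fun w => W t w - W 0 w) @^-1` B).
  rewrite -[X in measurable X]setTI; apply: measurable_BM_increment => //.
  by rewrite lexx ltW.
have mW : measurable (W t @^-1` B).
  by rewrite -[X in measurable X]setTI; apply: measurable_BM => //; exact: ltW.
(* As [W 0] vanishes only almost surely, the two events may differ by a null set; they are compared
   through integrals of their indicators. *)
have PE C : measurable C -> P C = (\int[P]_w (\1_C w)%:E)%E.
  by move=> mC; rewrite integral_indic// setIT.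
rewrite (PE _ mW) (PE _ mI).
apply: ae_eq_integral => //; try by apply/measurable_EFinP; exact: measurable_indic.
apply: filterS W0 => w Ww _; rewrite !indicE; congr ((nat_of_bool _)%:R%:E).
by apply/idP/idP; rewrite !inE /= Ww subr0.
Qed.

(** Write [W t] as [W s] plus an increment independent of the past up to [s], and integrate the
    increment out; its law is centred normal with variance [t - s]. *)
Lemma BM_markov s t f A : 0 <= s < t -> nat_filtration W s A ->
  measurable_fun setT f -> gauss_integrable f ->
  P.-integrable setT (fun w => (f (W t w))%:E) ->
  (\int[P]_(w in A) (f (W t w))%:E =
   \int[P]_(w in A) (gauss_avg (t - s) f (W s w))%:E)%E.
Proof.
move=> /[dup] st' /andP[s0 st] FA mf gf intf.
have mA := nat_filtration_measurable s0 FA.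
have t0 : 0 <= t by rewrite (le_trans s0)// ltW.
have preimage_memA : (fun w => w \in A) @^-1` [set true] = A.
  by apply/seteqP; split=> w /= => [/set_mem//|]; exact: mem_set.
(* The second component carries the restriction to A, so that a pair of
   independent variables is integrated over the whole space. *)
pose X w := (W s w, w \in A).
pose Z w := W t w - W s w.
have mX : measurable_fun setT X.
  apply: measurable_fun_pair; first exact: measurable_BM.
  apply: (measurable_fun_bool true); rewrite setTI.
  by rewrite preimage_memA.
have mZ : measurable_fun setT Z by apply: measurable_BM_increment; rewrite s0 ltW.
pose g (p : R * bool * R) : \bar R := (if p.1.2 then f (p.1.1 + p.2) else 0)%:E.
have mg : measurable_fun setT g.
  apply/measurable_EFinP; apply: measurable_fun_ifT => //.
    exact: measurableT_comp.
  apply: measurableT_comp => //; apply: measurable_funD => //.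
  exact: measurableT_comp.
(* Both components of [X] are measurable for the past up to [s], so independence of the increment
   extends to the pair. *)
have FX B : measurable B -> nat_filtration W s (X @^-1` B).
  move=> mB; pose G := [set A | exists r, exists B : set R,
    [/\ 0 <= r <= s, measurable B & A = W r @^-1` B]].
  have mXG : measurable_fun (setT : set (g_sigma_algebraType G)) X.
    apply: measurable_fun_pair => [_ C mC|].
      by rewrite setTI; apply: nat_filtration_preimage; rewrite ?s0 ?lexx.
    apply: (measurable_fun_bool true); rewrite setTI.
    by rewrite preimage_memA.
  by have := mXG measurableT _ mB; rewrite setTI.
have gXZ w : g (X w, Z w) = ((fun w => (f (W t w))%:E) \_ A) w.
  by rewrite /g /X /Z/= patchE; case: ifPn => // _; rewrite subrKC.
have avgE x : (\int[normal_prob 0 (Num.sqrt (t - s))]_z (f (x + z))%:E =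
               (gauss_avg (t - s) f x)%:E)%E.
  rewrite /gauss_avg /Rintegral fineK// integrable_fin_num//.
  by apply: integrable_gauss_avg; rewrite // subr_gt0.
rewrite integral_mkcond -(eq_integral _ _ (fun w _ => gXZ w)).
rewrite (@integral_independent _ _ _ _ _ _ _ P (normal_prob 0 (Num.sqrt (t - s))) X Z)//.
- rewrite [RHS]integral_mkcond; apply: eq_integral => w _.
  rewrite patchE /g /X/=; case: ifPn => wA; first by rewrite avgE.
  by rewrite integral0.
- by move=> B C mB mC; apply: BM_increment => //; exact: FX.
- apply: (eq_integrable measurableT ((fun w => (f (W t w))%:E) \_ A)) => [w _|].
    by rewrite gXZ.
  by apply/(integrable_mkcond _ mA); exact: integrableS intf.
Qed.

End brownian_motion.

(** * The martingale property and almost everywhere quadratic functions *)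

Section brownian_martingale.
Context {d : measure_display} {T : measurableType d} {R : realType}.
Variables (P : probability T R) (W : R -> T -> R).
Hypothesis BM : standard_BM P W.
Local Notation mu := (@lebesgue_measure R).
Implicit Types (f : R -> R) (s t : R) (A : set T).

Lemma integrable_BM_law f t : 0 < t -> measurable_fun setT f ->
  (normal_prob 0 (Num.sqrt t)).-integrable setT (EFin \o f) <->
  P.-integrable setT (EFin \o (f \o W t)).
Proof.
move=> t0 mf.
have mW : measurable_fun setT (W t : T -> measurableTypeR R).
  exact: (measurable_BM BM (ltW t0)).
apply: (integrable_pushforward_measurable mW).
  by move=> B mB; exact: BM_law.
exact/measurable_EFinP.
Qed.

Lemma gauss_integrable_BM f : measurable_fun setT f ->
  (forall t, 0 <= t -> P.-integrable setT (EFin \o (f \o W t))) ->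
  gauss_integrable f.
Proof.
move=> mf intf; apply: gauss_integrable_normal_prob => // h h0.
by apply/integrable_BM_law => //; apply: intf; exact: ltW.
Qed.

(** At a positive time the law of [W t] is a nondegenerate normal law and charges no Lebesgue-null
    set; at time 0 it is concentrated at 0. *)
Lemma ae_BM t (Q : R -> Prop) : 0 < t -> {ae mu, forall x, Q x} ->
  {ae P, forall w, Q (W t w)}.
Proof.
move=> t0 /(ae_normal_prob 0 Q (lt0r_neq0 (_ : 0 < Num.sqrt t))).
rewrite sqrtr_gt0 => /(_ t0)[N [mN N0 QN]]; exists (W t @^-1` N); split.
- by rewrite -[X in measurable X]setTI; exact: (measurable_BM BM (ltW t0) measurableT mN).
- by rewrite (BM_law BM t0).
- by move=> w /=; exact: QN.
Qed.

Lemma measurable_comp_BM f t : 0 <= t -> measurable_fun setT f ->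
  measurable_fun setT (f \o W t).
Proof. by move=> t0 mf; exact: (measurableT_comp mf (measurable_BM BM t0)). Qed.

Lemma expect_EFin (X : T -> R) : P.-integrable setT (EFin \o X) ->
  (\int[P]_w (X w)%:E)%E = (expect P X)%:E.
Proof. by move=> intX; rewrite /expect fineK// integrable_fin_num. Qed.

Lemma ae_eq_expect (X Y : T -> R) : measurable_fun setT X -> measurable_fun setT Y ->
  {ae P, forall w, X w = Y w} -> expect P X = expect P Y.
Proof.
move=> mX mY XY; rewrite /expect; congr fine.
apply: ae_eq_integral => //; [exact/measurable_EFinP|exact/measurable_EFinP|].
by apply: filterS XY => w -> .
Qed.

Lemma integral_centered (X : T -> R) (m : R) A : measurable A ->
  P.-integrable setT (EFin \o X) ->
  (\int[P]_(w in A) (X w - m)%:E = \int[P]_(w in A) (X w)%:E - m%:E * P A)%E.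
Proof.
move=> mA intX.
under eq_integral do rewrite EFinB.
rewrite integralB//.
- by rewrite integral_cst.
- exact: integrableS intX.
- by apply: (integrableS measurableT) => //; exact: finite_measure_integrable_cst.
Qed.

(** Test the martingale identity between times 1 and [1 + h] on the events that [W 1] lies in [B].
    By the Markov property, [gauss_avg h f] and [f] plus a constant have equal integrals over every
    [B] under the law of [W 1], which has the null sets of Lebesgue measure. *)
Lemma martingale_gauss_avg f : measurable_fun setT f ->
  (forall t, 0 <= t -> P.-integrable setT (EFin \o (f \o W t))) ->
  martingale P (nat_filtration W)
    (fun t w => f (W t w) - expect P (f \o W t)) ->
  forall h, 0 < h -> exists k, {ae mu, forall x, gauss_avg h f x = f x + k}.
Proof.
move=> mf intf [_ _ mart] h h0.
have gf := gauss_integrable_BM mf intf.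
(* The shift is the difference of the two centring constants. *)
pose k := expect P (f \o W (1 + h)) - expect P (f \o W 1); exists k.
have h1_ge0 : 0 <= 1 + h by rewrite addr_ge0// ltW.
have mfk : measurable_fun setT (EFin \o (fun x => f x + k)).
  by apply/measurable_EFinP; exact: measurable_funD.
have mavg : measurable_fun setT (EFin \o gauss_avg h f).
  apply/measurable_EFinP; apply: continuous_measurable_fun.
  exact: continuous_gauss_avg.
have s0 : Num.sqrt 1 != 0 :> R by rewrite sqrtr1.
apply/(ae_normal_prob 0 _ s0).
suff : ae_eq (normal_prob 0 (Num.sqrt 1)) setT (EFin \o (fun x => f x + k))
    (EFin \o gauss_avg h f).
  case=> N [mN N0 NE]; exists N; split=> // x /= xN; apply: NE => /= E.
  by apply: xN; case: (E I).
have intfk : P.-integrable setT (EFin \o ((fun x => f x + k) \o W 1)).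
  apply: (eq_integrable measurableT (fun w => (f (W 1 w))%:E + k%:E)%E) => //.
  by apply: integrableD => //; [exact: intf|exact: finite_measure_integrable_cst].
apply: integral_ae_eq => //.
  by apply/integrable_BM_law => //; exact: measurable_funD.
move=> B _ mB.
have pushE g : measurable_fun setT g -> (\int[normal_prob 0 (Num.sqrt 1)]_(x in B) g x =
    \int[P]_(w in W 1 @^-1` B) g (W 1 w))%E.
  move=> mg; apply/esym.
  have mW : measurable_fun setT (W 1 : T -> measurableTypeR R).
    exact: (measurable_BM BM ler01).
  apply: (integral_pushforward_measurable mW) => //.
    by move=> C mC; exact: BM_law.
  exact: measurable_funTS.
rewrite !pushE//=.
have FB : nat_filtration W 1 (W 1 @^-1` B).
  by apply: nat_filtration_preimage => //; rewrite ler01 lexx.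
have mWB := nat_filtration_measurable BM ler01 FB.
have lt1h : 0 <= (1 : R) < 1 + h by rewrite ler01 ltrDl.
have := BM_markov BM lt1h FB mf gf (intf _ h1_ge0).
have -> : 1 + h - 1 = h by ring.
move=> <-.
have le1h : 0 <= (1 : R) <= 1 + h by rewrite ler01 lerDl ltW.
have := mart _ _ _ le1h FB.
rewrite !integral_centered//; try exact: intf.
move=> E.
transitivity (\int[P]_(w in W 1 @^-1` B) (f (W 1 w) - (- k))%:E)%E.
  by apply: eq_integral => w _; rewrite opprK.
rewrite integral_centered//; last exact: intf.
have fin_int t : 0 <= t -> (\int[P]_(w in W 1 @^-1` B) (f (W t w))%:E)%E \is a fin_num.
  by move=> t0; apply: integrable_fin_num => //; exact: integrableS (intf _ t0).
move: E; rewrite -(fineK (fin_int _ ler01)) -(fineK (fin_int _ h1_ge0)).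
rewrite -(fineK (fin_num_measure P _ mWB)) -!EFinM -!EFinB => -[] E.
by congr EFin; move: E; rewrite /k; lra.
Qed.

Section quadratic.
Variables a b c : R.
Let q x := a * x ^+ 2 + b * x + c.

Lemma measurable_quadratic : measurable_fun setT q.
Proof.
apply: measurable_funD => //; apply: measurable_funD.
  by apply: measurable_funM => //; exact: exprn_measurable.
exact: mulrl_measurable.
Qed.

Lemma ae_BM0 f : {ae P, forall w, f (W 0 w) = f 0}.
Proof. by case: BM => _ + _ _ _; apply: filterS => w ->. Qed.

Lemma integrable_quadratic_BM t : 0 <= t -> P.-integrable setT (EFin \o (q \o W t)).
Proof.
(* Time 0 is separate because the law of [W 0] is degenerate: there the variable is almost surely
   the constant [q 0]. *)
rewrite le_eqVlt => /predU1P[<-|t0].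
  have intq0 : P.-integrable setT (EFin \o (fun=> q 0)).
    exact: finite_measure_integrable_cst.
  apply/integrableP; split.
    by apply/measurable_EFinP; apply: measurable_comp_BM => //; exact: measurable_quadratic.
  have /integrableP[_] := intq0.
  rewrite (ae_eq_integral (fun w => `|(q (W 0 w))%:E|)%E)//.
  - apply/measurableT_comp => //; apply/measurable_EFinP.
    by apply: measurable_comp_BM => //; exact: measurable_quadratic.
  - by apply: filterS (ae_BM0 q) => w /= ->.
apply/integrable_BM_law => //; first exact: measurable_quadratic.
have intp k := integrable_normal_prob_pow t0 k.
have intc : (normal_prob 0 (Num.sqrt t)).-integrable setT (EFin \o (fun=> c)).
  exact: finite_measure_integrable_cst.
apply: (eq_integrable measurableT
  (fun x : measurableTypeR R => a%:E * (x ^+ 2)%:E + b%:E * (x ^+ 1)%:E + c%:E)%E) => //.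
apply: integrableD => //; apply: integrableD => //.
- by apply: integrableZl => //; exact: intp.
- by apply: integrableZl => //; exact: intp.
Qed.

(** The Markov property reduces the claim to [gauss_avg_quadratic] with step [t - s], whose extra
    constant is the drift term. *)
Lemma integral_quadratic_BM s t A : 0 <= s <= t -> nat_filtration W s A ->
  (\int[P]_(w in A) (q (W t w))%:E =
   \int[P]_(w in A) (q (W s w))%:E + (a * (t - s))%:E * P A)%E.
Proof.
move=> /andP[s0]; rewrite le_eqVlt => /predU1P[<- FA|st FA].
  by rewrite subrr mulr0 mul0e adde0.
have t0 : 0 <= t by rewrite (le_trans s0)// ltW.
have st' : 0 <= s < t by rewrite s0.
have mA := nat_filtration_measurable BM s0 FA.
have gq := gauss_integrable_BM measurable_quadratic integrable_quadratic_BM.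
rewrite (BM_markov BM st' FA measurable_quadratic gq (integrable_quadratic_BM t0)).
transitivity (\int[P]_(w in A) (q (W s w) - (- (a * (t - s))))%:E)%E.
  apply: eq_integral => w _; rewrite opprK.
  by rewrite gauss_avg_quadratic// subr_gt0.
rewrite integral_centered//; last exact: integrable_quadratic_BM.
by rewrite EFinN mulNe oppeK.
Qed.

Lemma expect_quadratic_BM t : 0 <= t ->
  expect P (q \o W t) = expect P (q \o W 0) + a * t.
Proof.
move=> t0; apply: EFin_inj; rewrite EFinD.
rewrite -!expect_EFin; try exact: integrable_quadratic_BM.
rewrite (@integral_quadratic_BM 0 t setT)//=; last exact: nat_filtrationT.
  by rewrite subr0 probability_setT mule1.
by rewrite lexx.
Qed.

Section ae_quadratic.
Variable f : R -> R.
Hypotheses (mf : measurable_fun setT f) (fq : {ae mu, forall x, f x = q x}).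

Lemma ae_quadratic_BM t : 0 < t -> {ae P, forall w, f (W t w) = q (W t w)}.
Proof. by move=> t0; exact: (ae_BM t0 fq). Qed.

Lemma expect_ae_quadratic t : 0 < t -> expect P (f \o W t) = expect P (q \o W t).
Proof.
move=> t0; apply: ae_eq_expect; last exact: ae_quadratic_BM.
- by apply: measurable_comp_BM => //; exact: ltW.
- by apply: measurable_comp_BM; [exact: ltW|exact: measurable_quadratic].
Qed.

(** At each time the process agrees almost surely with its analogue for [q], and there the drift
    over an event cancels against the growth of the expectation. *)
Lemma martingale_ae_quadratic :
  (forall t, 0 <= t -> P.-integrable setT (EFin \o (f \o W t))) ->
  martingale P (nat_filtration W)
    (fun t w => f (W t w) - expect P (f \o W t)).
Proof.
move=> intf.
have expect0 g : measurable_fun setT g -> expect P (g \o W 0) = g 0.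
  move=> mg; rewrite (@ae_eq_expect _ (fun=> g 0))//.
  - by rewrite /expect (integral_cst P measurableT) [X in (_ * X)%E](probability_setT P) mule1.
  - exact: measurable_comp_BM.
  - exact: ae_BM0.
have aeM t : 0 <= t -> {ae P, forall w, f (W t w) - expect P (f \o W t) =
                                     q (W t w) - expect P (q \o W t)}.
  (* At time 0 the values [f 0] and [q 0] may differ, but centring makes both sides vanish almost
     surely. *)
  rewrite le_eqVlt => /predU1P[<-|t0].
    rewrite !expect0//; last exact: measurable_quadratic.
    by apply: filterS2 (ae_BM0 f) (ae_BM0 q) => w -> ->; rewrite !subrr.
  rewrite expect_ae_quadratic//.
  by apply: filterS (ae_quadratic_BM t0) => w ->.
split.
- move=> t t0 B mB.
  have mfB : measurable ((fun x => f x - expect P (f \o W t)) @^-1` B).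
    rewrite -[X in measurable X]setTI; apply: measurable_funB => //.
  by apply: (@nat_filtration_preimage _ _ _ W t t _ _ mfB); rewrite t0 lexx.
- move=> t t0.
  apply: (eq_integrable measurableT
    (fun w => (f (W t w))%:E - (expect P (f \o W t))%:E)%E) => //.
  by apply: integrableB => //; [exact: intf|exact: finite_measure_integrable_cst].
- move=> s t A /[dup] st /andP[s0 le_st] FA.
  have t0 := le_trans s0 le_st.
  have mA := nat_filtration_measurable BM s0 FA.
  have intM r : 0 <= r -> (\int[P]_(w in A) (f (W r w) - expect P (f \o W r))%:E =
      \int[P]_(w in A) (q (W r w) - expect P (q \o W r))%:E)%E.
    move=> r0; apply: ae_eq_integral => //.
    + apply/measurable_EFinP/measurable_funTS; apply: measurable_funB => //.
      exact: measurable_comp_BM.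
    + apply/measurable_EFinP/measurable_funTS; apply: measurable_funB => //.
      by apply: measurable_comp_BM => //; exact: measurable_quadratic.
    + by apply: filterS (aeM _ r0) => w ->.
  rewrite (intM _ t0) (intM _ s0).
  rewrite (integral_centered _ mA (integrable_quadratic_BM t0)).
  rewrite (integral_centered _ mA (integrable_quadratic_BM s0)).
  rewrite (integral_quadratic_BM st FA) (expect_quadratic_BM t0) (expect_quadratic_BM s0).
  have fin_int : (\int[P]_(w in A) (q (W s w))%:E)%E \is a fin_num.
    by apply: integrable_fin_num => //; exact: integrableS (integrable_quadratic_BM s0).
  rewrite -(fineK fin_int) -(fineK (fin_num_measure P _ mA)).
  rewrite -!EFinM -EFinD -!EFinB; congr EFin; ring.
Qed.

End ae_quadratic.
End quadratic.
End brownian_martingale.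

(** * Path properties: hitting points and right-continuity *)

Section brownian_paths.
Context {d : measure_display} {T : measurableType d} {R : realType}.
Variables (P : probability T R) (W : R -> T -> R).
Hypothesis BM : standard_BM P W.
Local Notation mu := (@lebesgue_measure R).
Implicit Types (f : R -> R) (s t : R) (w : T).

Lemma right_continuous_path w t : 0 <= t ->
  {within `[0, +oo[, continuous (fun t => W t w)} ->
  (fun s => W s w) @ t^'+ --> W t w.
Proof.
rewrite le_eqVlt => /predU1P[<-|t0] /continuous_within_itvcyP[cW cW0] //.
by apply: cvg_at_right_filter; apply: cW; rewrite in_itv/= t0.
Qed.

Lemma normal_prob_itv_gt0 (m s x y : R) : s != 0 -> x < y ->
  (0 < normal_prob m s `]x, y[%classic)%E.
Proof.
move=> s0 xy; rewrite lt_neqAle measure_ge0 andbT eq_sym; apply/eqP.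
move=> /(normal_prob_eq0 s0 (measurable_itv _)).
rewrite [LHS]lebesgue_measure_itv/= lte_fin xy => -[] /eqP.
by rewrite subr_eq0 gt_eqF.
Qed.

(* With positive probability [W 1] lies just above [x] and [W 2] below it;
   the path then crosses [x]. *)
Lemma BM_hits x (Q : T -> Prop) : {ae P, forall w, Q w} ->
  exists w t, [/\ Q w, 0 < t & W t w = x].
Proof.
move=> aeQ; have [_ _ cont _ _] := BM.
have [N [mN N0 QN]] : {ae P, forall w, Q w /\
    {within `[0, +oo[, continuous (fun t => W t w)}}.
  by apply: filterS2 aeQ cont.
pose A := W 1 @^-1` `]x, x + 1[%classic.
(* On [A] the path is below [x + 1] at time 1, so an increment below -1 brings it under [x] at time
   2. *)
pose B := (fun w => W 2 w - W 1 w) @^-1` `]-2, -1[%classic.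
have FA : nat_filtration W 1 A.
  by apply: nat_filtration_preimage; rewrite ?ler01 ?lexx.
have lt12 : 0 <= (1 : R) < 2 by rewrite ler01 ltr1n.
have le12 : 0 <= (1 : R) <= 2 by rewrite ler01 ler1n.
have AB_gt0 : (0 < P (A `&` B))%E.
  rewrite (BM_increment BM lt12 FA)// (BM_law BM ltr01)//.
  rewrite mule_gt0// normal_prob_itv_gt0 ?gt_eqF ?sqrtr_gt0 ?ltrDl ?subr_gt0//.
    by rewrite ltr1n.
  by rewrite ltrN2 ltr1n.
have mAB : measurable (A `&` B).
  apply: measurableI; first exact: (nat_filtration_measurable BM ler01 FA).
  rewrite -[X in measurable X]setTI.
  exact: (measurable_BM_increment BM le12 measurableT (measurable_itv _)).
have [w [[Aw Bw] NNw]] : exists w, (A `&` B) w /\ ~ N w.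
  apply: contrapT => noex; move: AB_gt0.
  rewrite (subset_measure0 mAB mN) ?ltxx// => w ABw.
  by apply: contrapT => NNw; apply: noex; exists w.
have [Qw Ww] : Q w /\ {within `[0, +oo[, continuous (fun t => W t w)}.
  by apply: contrapT => nQ; apply: NNw; exact: QN.
move: Aw Bw; rewrite /A /B /= !in_itv/= => /andP[W1gt W1lt] /andP[_ W2lt].
have W12 : {within `[1, 2], continuous (fun t => W t w)}.
  apply: continuous_subspaceW Ww => t /=; rewrite !in_itv/= andbT => /andP[t1 _].
  exact: le_trans t1.
have [t t12 Wt] : exists2 t, t \in `[1, 2] & W t w = x.
  apply: IVT => //; first by rewrite ler1n.
  have W2x : W 2 w < x by lra.
  by rewrite ge_min le_max (ltW W2x) (ltW W1gt) orbT.
exists w, t; split=> //.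
by move: t12; rewrite in_itv/= => /andP[t1 _]; exact: lt_le_trans t1.
Qed.

Section quadratic.
Variables (f : R -> R) (a b c : R).
Let q x := a * x ^+ 2 + b * x + c.
Let Mf t w := f (W t w) - expect P (f \o W t).
Let Mq t w := q (W t w) - expect P (q \o W t).

Let quadratic_cvg w t : 0 <= t ->
  {within `[0, +oo[, continuous (fun t => W t w)} ->
  (fun s => Mq s w) @ t^'+ --> Mq t w.
Proof.
move=> t0 Ww; have Wt := right_continuous_path t0 Ww.
rewrite /Mq (expect_quadratic_BM BM a b c t0).
(* The affine formula for the expectation holds at nonnegative times, hence to the right of [t]. *)
have E : {near t^'+, (fun s => q (W s w) - (expect P (q \o W 0) + a * s)) =1
                     (fun s => q (W s w) - expect P (q \o W s))}.
  near=> s; have s0 : 0 <= s.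
    by apply: (le_trans t0); near: s; exact: nbhs_right_ge.
  by rewrite /= (expect_quadratic_BM BM a b c s0).
apply: cvg_trans (near_eq_cvg E) _.
have cvg_id : (fun s : R => s) @ t^'+ --> t by apply: cvg_at_right_filter; exact: cvg_id.
apply: cvgB; last by apply: cvgD; [exact: cvg_cst|apply: cvgM => //; exact: cvg_cst].
apply: cvgD; last exact: cvg_cst.
apply: cvgD; apply: cvgM => //; try exact: cvg_cst.
by rewrite expr2; under eq_fun do rewrite expr2; exact: cvgM.
Unshelve. all: by end_near. Qed.

Lemma as_right_continuous_quadratic : as_right_continuous P Mq.
Proof.
have [_ _ cont _ _] := BM.
by apply: filterS cont => w Ww t t0; exact: quadratic_cvg.
Qed.

Lemma right_continuous_ae_quadratic : measurable_fun setT f ->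
  {ae mu, forall x, f x = q x} -> as_right_continuous P Mf ->
  forall x, f x = q x.
Proof.
move=> mf fq rc x; have [_ _ cont _ _] := BM.
(* Enumerating the rationals by [unpickle] makes the exceptional sets a countable family, with a
   null union. *)
have aeM : {ae P, forall w (n : nat) (r : rat), unpickle n = Some r -> 0 < ratr r :> R ->
    Mf (ratr r) w = Mq (ratr r) w}.
  apply: ae_foralln => n; case: (unpickle n : option rat) => [r|]; last exact: aeW.
  have [r0|r0] := ltP 0 (ratr r : R); last first.
    by apply: aeW => w _ [<-]; rewrite ltNge r0.
  apply: filterS (ae_quadratic_BM BM fq r0) => w fqw _ [<-] _.
  by rewrite /Mf /Mq fqw (expect_ae_quadratic BM mf fq r0).
(* One path serves for the given point: it is regular, agrees with the quadratic at positive
   rational times, and visits [x] at a positive time. *)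
have [w [t [[[rcw Ww] Mw] t0 <-]]] := BM_hits x (filterI (filterI rc cont) aeM).
pose D s := Mf s w - Mq s w.
have D_rat (r : rat) : 0 < ratr r :> R -> D (ratr r) = 0.
  by move=> r0; rewrite /D (Mw (pickle r) r (pickleK r) r0) subrr.
have D_cvg : D s @[s --> t^'+] --> D t.
  by apply: cvgB; [exact: rcw (ltW t0)|exact: quadratic_cvg (ltW t0) Ww].
have Dt0 : D t = 0.
  (* A nonzero limit would keep [D] away from 0 just after [t], where rational times give the value
     0. *)
  apply/eqP; apply: contrapT => /negP Dt.
  move/cvgrPdist_lt : D_cvg => /(_ `|D t|); rewrite normr_gt0 => /(_ Dt).
  move=> [e /= e0 De].
  have tte : t < t + e by rewrite ltrDl.
  have [r] := rat_in_itvoo tte; rewrite in_itv/= => /andP[tr rte].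
  have := De (ratr r); rewrite /= D_rat ?(lt_trans t0)// subr0 ltxx => F.
  suff /F/(_ tr) : `|t - ratr r| < e by [].
  by rewrite ltr0_norm ?subr_lt0// opprB ltrBlDl.
apply/eqP; rewrite -subr_eq0 -Dt0 /D /Mf /Mq (expect_ae_quadratic BM mf fq t0).
by apply/eqP; ring.
Qed.

End quadratic.
End brownian_paths.

Theorem theorem2 (d : measure_display) (T : measurableType d) (R : realType)
  (P : probability T R) (W : R -> T -> R) (f : R -> R) :
  complete_prob P ->
  standard_BM P W ->
  measurable_fun setT f ->
  (forall t, 0 <= t -> P.-integrable setT (EFin \o (f \o W t))) ->
  let M := fun t w => f (W t w) - expect P (f \o W t) in
  ((martingale P (nat_filtration W) M /\ as_right_continuous P M) <->
     exists a b c : R, forall x, f x = a * x ^+ 2 + b * x + c)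
  /\
  (martingale P (nat_filtration W) M <->
     exists a b c : R,
       {ae (@lebesgue_measure R), forall x, f x = a * x ^+ 2 + b * x + c}).
Proof.
move=> _ BM mf intf M.
have mart_iff : martingale P (nat_filtration W) M <-> exists a b c : R,
    {ae (@lebesgue_measure R), forall x, f x = a * x ^+ 2 + b * x + c}.
  split=> [mart|[a [b [c fq]]]].
    apply: gauss_avg_shift_quadratic => //; first exact: gauss_integrable_BM intf.
    exact: martingale_gauss_avg mart.
  exact: martingale_ae_quadratic fq intf.
split=> //; split=> [[/mart_iff[a [b [c fq]]] rc]|[a [b [c fq]]]].
  by exists a, b, c; exact: right_continuous_ae_quadratic fq rc.
split; first by apply/mart_iff; exists a, b, c; exact: aeW.
rewrite /M (_ : f = fun x => a * x ^+ 2 + b * x + c); last exact/funext.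
exact: as_right_continuous_quadratic.
Qed.
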